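(* Assume: (A1) $A:\mathbb R^n\times\mathbb R^m\to\mathbb R^{n\times n}$ and $B:\mathbb R^n\times\mathbb R^m\to\mathbb R^{n\times m}$ are continuously differentiable and there exist $L_A,L_B\in(0,\infty)$ such that for all $x,\hat x\in\mathbb R^n$, $u,\hat u\in\mathbb R^m$, $\|A(x,u)-A(\hat x,\hat u)\|\le L_A(\|x-\hat x\|+\|u-\hat u\|)$ and $\|B(x,u)-B(\hat x,\hat u)\|\le L_B(\|x-\hat x\|+\|u-\hat u\|)$; (A3) with $A_0=A(0,0)$, $B_0=B(0,0)$, the pair $(A_0,B_0)$ is stabilizable and the pair $(A_0,Q^{1/2})$ is detectable; and that $Q$ is positive definite, $0\in\mathrm{int}\,\mathcal X$, and $0\in\mathrm{int}\,\mathcal U$. Consider the system $x_{k+1}=f(x_k,u_k)$ with $u_k=\kappa_{\rm f}(x_k)$ for all $k\in\mathbb N$, and define $V_{\rm f}(x)=x^TPx$ for $x\in\mathbb R^n$. Then there exists $\alpha\in(0,\infty)$ such that the sublevel set $\mathcal X_{\rm f}=\{x\in\mathbb R^n:V_{\rm f}(x)\le\alpha\}$ satisfies: (i) $\mathcal X_{\rm f}\subseteq\mathcal X$, and, for all $x\in\mathcal X_{\rm f}$, $\kappa_{\rm f}(x)\in\mathcal U$. (ii) For all $x\in\mathcal X_{\rm f}$, $f(x,\kappa_{\rm f}(x))\in\mathcal X_{\rm f}$. (iii) For all $x\in\mathcal X_{\rm f}$, $V_{\rm f}(f(x,\kappa_{\rm f}(x)))-V_{\rm f}(x)\le-x^TQx-\kappa_{\rm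 f}(x)^TR\,\kappa_{\rm f}(x)$.
   Context: $\mathbb N=\{0,1,2,\ldots\}$; $\|\cdot\|$ is the Euclidean norm on vectors and the induced norm on matrices. $f(x,u)=A(x,u)x+B(x,u)u$ for all $x\in\mathbb R^n$, $u\in\mathbb R^m$. $\mathcal X\subseteq\mathbb R^n$ and $\mathcal U\subseteq\mathbb R^m$ are closed sets. $Q\in\mathbb R^{n\times n}$ and $R\in\mathbb R^{m\times m}$ are symmetric, $R$ positive definite. $P$ is the unique (symmetric positive definite) stabilizing solution of the discrete algebraic Riccati equation $P=A_0^TPA_0-A_0^TPB_0(2R+B_0^TPB_0)^{-1}B_0^TPA_0+2Q$. The terminal control law is $\kappa_{\rm f}(x)=K_{\rm f}x$ with $K_{\rm f}=-(2R+B_0^TPB_0)^{-1}B_0^TPA_0$. *)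

(* Defs.v *)
From mathcomp Require Import all_boot all_order all_algebra.
From mathcomp Require Import complex.
From mathcomp Require Import all_classical all_reals all_analysis.

Set Implicit Arguments.
Unset Strict Implicit.
Unset Printing Implicit Defensive.

Import Order.TTheory GRing.Theory Num.Theory.
Import numFieldNormedType.Exports.

Local Open Scope classical_set_scope.
Local Open Scope ring_scope.

(* The library norm `|x| on matrices and column vectors is the max norm; it is
   used below only for notions that do not depend on the choice of equivalent
   norm (closedness, interior, continuous differentiability).  The norms of
   quantitative estimates are the following two. *)
Definition enorm (K : realType) (n : nat) (x : 'cV[K]_n) : K :=
  Num.sqrt (\sum_(i < n) x i 0 ^+ 2).

Definition opnorm (K : realType) (p n : nat) (M : 'M[K]_(p, n)) : K :=
  sup [set enorm (M *m x) | x in [set x : 'cV[K]_n | enorm x <= 1]].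

(* The second clause is continuity of z |-> 'd f z for the operator norm. *)
Definition continuously_differentiable (K : realType) (V W : normedModType K)
    (f : V -> W) : Prop :=
  (forall z, differentiable f z) /\
  (forall z (e : K), 0 < e ->
     \forall z' \near z, forall v, `|'d f z' v - 'd f z v| <= e * `|v|).

Definition qform (K : realType) (n : nat) (M : 'M[K]_n) (x : 'cV[K]_n) : K :=
  (x^T *m M *m x) 0 0.

Definition posdef (K : realType) (n : nat) (M : 'M[K]_n) : Prop :=
  M^T = M /\ forall x : 'cV[K]_n, x != 0 -> 0 < qform M x.

Definition possemidef (K : realType) (n : nat) (M : 'M[K]_n) : Prop :=
  M^T = M /\ forall x : 'cV[K]_n, 0 <= qform M x.

Definition is_principal_sqrt (K : realType) (n : nat) (M S : 'M[K]_n) : Prop :=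
  possemidef S /\ S *m S = M.

(* The order of K[i] compares elements with equal imaginary part, and the norm
   `|z| is the modulus, seen as an element of K[i]. *)
Definition schur_stable (K : realType) (n : nat) (M : 'M[K]_n) : Prop :=
  forall z : complex K, eigenvalue (map_mx (real_complex K) M) z -> `|z| < 1.

Definition stabilizable (K : realType) (n m : nat)
    (A : 'M[K]_n) (B : 'M[K]_(n, m)) : Prop :=
  exists F : 'M[K]_(m, n), schur_stable (A + B *m F).

Definition detectable (K : realType) (n p : nat)
    (A : 'M[K]_n) (C : 'M[K]_(p, n)) : Prop :=
  exists L : 'M[K]_(n, p), schur_stable (A + L *m C).

Definition dare_gain (K : realType) (n m : nat) (A : 'M[K]_n)
    (B : 'M[K]_(n, m)) (R : 'M[K]_m) (P : 'M[K]_n) : 'M[K]_(m, n) :=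
  - (invmx (2 *: R + B^T *m P *m B) *m B^T *m P *m A).

Definition dare (K : realType) (n m : nat) (A : 'M[K]_n) (B : 'M[K]_(n, m))
    (Q : 'M[K]_n) (R : 'M[K]_m) (P : 'M[K]_n) : Prop :=
  P = A^T *m P *m A
      - A^T *m P *m B *m invmx (2 *: R + B^T *m P *m B) *m B^T *m P *m A
      + 2 *: Q.

Definition stabilizing_dare_solution (K : realType) (n m : nat) (A : 'M[K]_n)
    (B : 'M[K]_(n, m)) (Q : 'M[K]_n) (R : 'M[K]_m) (P : 'M[K]_n) : Prop :=
  dare A B Q R P /\ schur_stable (A + B *m dare_gain A B R P).

Definition dynamics (K : realType) (n m : nat)
    (A : 'cV[K]_n -> 'cV[K]_m -> 'M[K]_n)
    (B : 'cV[K]_n -> 'cV[K]_m -> 'M[K]_(n, m))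
    (x : 'cV[K]_n) (u : 'cV[K]_m) : 'cV[K]_n :=
  A x u *m x + B x u *m u.

(* Main.v *)
Require Import Defs.
From mathcomp Require Import all_boot all_order all_algebra.
From mathcomp Require Import complex.
From mathcomp Require Import all_classical all_reals all_analysis.
From mathcomp Require Import ring lra.

Set Implicit Arguments.
Unset Strict Implicit.
Unset Printing Implicit Defensive.

Import Order.TTheory GRing.Theory Num.Theory.
Import numFieldNormedType.Exports.

Local Open Scope classical_set_scope.
Local Open Scope ring_scope.

(** The terminal law and P come from the linear-quadratic problem of the
    linearization with the doubled weights 2 Q and 2 R.  Put
    W = Q + Kf^T R Kf and let Acl(x) = A(x, Kf x) + B(x, Kf x) Kf, so that the
    closed loop is x |-> Acl(x) x.  The Riccati equation says
    Acl(0)^T P Acl(0) = P - 2 W ([dare_closed_loop]), that is, the decrease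
    along the linearized closed loop is twice the one required by (iii).

    The decrease (iii) at x is the nonnegativity at x of the quadratic form of
    the slack P - W - Acl(x)^T P Acl(x).  Since A and B are continuous at 0, the
    slack tends to W as x tends to 0 ([cvg_lyapunov_slack]).  As W is positive
    definite, every matrix near W has a nonnegative form ([posdef_near_ge0]), so
    (iii) holds on some ball around 0.  Shrinking the ball, it also lies in X
    and its image under Kf lies in U.

    Coercivity of P ([posdef_coercive]) puts a small sublevel set of the
    terminal cost inside that ball, which gives (i) and (iii); (ii) follows from
    (iii) because Q and R are positive definite. *)

(** * Quadratic forms and positive definite matrices *)

Section QuadraticForms.
Context {K : realType}.

Lemma qformDl n (M N : 'M[K]_n) x : qform (M + N) x = qform M x + qform N x.
Proof. by rewrite /qform mulmxDr mulmxDl mxE. Qed.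

Lemma qformNl n (M : 'M[K]_n) x : qform (- M) x = - qform M x.
Proof. by rewrite /qform mulmxN mulNmx mxE. Qed.

Lemma qformZl n a (M : 'M[K]_n) x : qform (a *: M) x = a * qform M x.
Proof. by rewrite /qform -scalemxAr -scalemxAl mxE. Qed.

Lemma qform_congr n p (M : 'M[K]_n) (N : 'M[K]_(n, p)) x :
  qform (N^T *m M *m N) x = qform M (N *m x).
Proof. by rewrite /qform trmx_mul !mulmxA. Qed.

Lemma qform0 n (M : 'M[K]_n) : qform M 0 = 0.
Proof. by rewrite /qform mulmx0 mxE. Qed.

Lemma qform_sum n (M : 'M[K]_n) x :
  qform M x = \sum_j (\sum_i x i 0 * M i j) * x j 0.
Proof.
by rewrite /qform mxE; apply: eq_bigr => j _; rewrite mxE;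
  congr (_ * _); apply: eq_bigr => i _; rewrite mxE.
Qed.

Lemma qform_line n (M : 'M[K]_n) (x y : 'cV[K]_n) t : M^T = M ->
  qform M (x - t *: y)
  = qform M x - 2 * t * (x^T *m (M *m y)) 0 0 + t ^+ 2 * qform M y.
Proof.
move=> sM.
have sym : (y^T *m M *m x) 0 0 = (x^T *m M *m y) 0 0.
  have -> : y^T *m M *m x = (x^T *m M *m y)^T.
    by rewrite !trmx_mul trmxK sM mulmxA.
  by rewrite mxE.
have trE : (x - t *: y)^T = x^T - t *: y^T by apply/matrixP => i j; rewrite !mxE.
rewrite /qform trE !(mulmxBl, mulmxBr) -!(scalemxAl, scalemxAr) mulmxA.
move: sym; rewrite !mxE => ->; ring.
Qed.

Lemma posdef_ge0 n (M : 'M[K]_n) x : posdef M -> 0 <= qform M x.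
Proof.
case=> _ pM; have [->|/pM/ltW //] := eqVneq x 0.
by rewrite qform0.
Qed.

Lemma posdef_unitmx n (M : 'M[K]_n) : posdef M -> M \in unitmx.
Proof.
case=> sM pM; rewrite -row_free_unit; apply: inj_row_free => v vM0.
apply/eqP/negPn/negP => v0.
have /pM : v^T != 0 by rewrite trmx_eq0.
by rewrite /qform trmxK vM0 mul0mx mxE ltxx.
Qed.

Lemma posdefD_congr n p (M : 'M[K]_n) (N : 'M[K]_p) (F : 'M[K]_(p, n)) :
  posdef M -> posdef N -> posdef (M + F^T *m N *m F).
Proof.
move=> [sM pM] pN; split=> [|x x0].
  by rewrite linearD /= !trmx_mul trmxK sM pN.1 mulmxA.
by rewrite qformDl qform_congr ltr_pwDl ?pM ?posdef_ge0.
Qed.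

Lemma posdefZ n a (M : 'M[K]_n) : 0 < a -> posdef M -> posdef (a *: M).
Proof.
move=> a0 [sM pM]; split=> [|x /pM x0]; first by rewrite linearZ /= sM.
by rewrite qformZl mulr_gt0.
Qed.

(** Cauchy-Schwarz for the inner product of M: with y = M^-1 e_i the coordinate
    x_i is x^T M y, so x_i^2 <= (y^T M y) (x^T M x).  It is obtained by
    evaluating the form at x - (x_i / (y^T M y)) y. *)
Lemma posdef_entry_le n (M : 'M[K]_n) (i : 'I_n) : posdef M ->
  exists2 s, 0 < s & forall x : 'cV[K]_n, x i 0 ^+ 2 <= s * qform M x.
Proof.
move=> pM; have uM := posdef_unitmx pM; pose y : 'cV[K]_n := invmx M *m delta_mx i 0.
have My : M *m y = delta_mx i 0 by rewrite mulKVmx.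
have s0 : 0 < qform M y.
  apply: pM.2; apply/eqP => y0; move: My; rewrite y0 mulmx0 => /matrixP/(_ i 0).
  by rewrite !mxE !eqxx => /esym/eqP; rewrite oner_eq0.
exists (qform M y) => // x.
have xMy : (x^T *m (M *m y)) 0 0 = x i 0 by rewrite My -colE !mxE.
have := posdef_ge0 (x - (x i 0 / qform M y) *: y) pM.
rewrite qform_line ?pM.1 // xMy.
set s := qform M y in s0 *; set V := qform M x; set a := x i 0 => h.
have {h} : 0 <= V - a ^+ 2 / s.
  by move: h; congr (_ <= _); field; rewrite gt_eqF.
by rewrite subr_ge0 ler_pdivrMr // mulrC.
Qed.

Lemma mx_norm_le m n (x : 'M[K]_(m, n)) e : 0 <= e ->
  (forall i j, `|x i j| <= e) -> `|x| <= e.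
Proof.
move=> e0 xe; rewrite [leLHS]/Num.Def.normr/= mx_normrE.
by apply: bigmax_le => // -[i j] _; exact: xe.
Qed.

Lemma entry_le_mx_norm m n (x : 'M[K]_(m, n)) i j : `|x i j| <= `|x|.
Proof.
rewrite [leRHS]/Num.Def.normr/= mx_normrE.
by apply/bigmax_geP; right => /=; exists (i, j).
Qed.

(** Summing the constants of the coordinate bounds gives a constant valid for all
    coordinates at once, hence for the max norm.  The added 1 keeps it positive
    when n = 0, where the sum is empty. *)
Lemma posdef_coercive n (M : 'M[K]_n) : posdef M ->
  exists2 c, 0 < c & forall x, c * `|x| ^+ 2 <= qform M x.
Proof.
move=> pM.
have /choice[s sP] : forall i, exists s,
    0 < s /\ forall x : 'cV[K]_n, x i 0 ^+ 2 <= s * qform M x.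
  by move=> i; have [s s0 sM] := posdef_entry_le i pM; exists s.
pose S := 1 + \sum_i s i.
have S0 : 0 < S.
  by rewrite ltr_pwDl // sumr_ge0 // => i _; rewrite ltW // (sP i).1.
exists S^-1; first by rewrite invr_gt0.
move=> x; rewrite mulrC ler_pdivrMr //.
have V0 := posdef_ge0 x pM.
have SV0 : 0 <= qform M x * S by rewrite mulr_ge0 // ltW.
rewrite -(sqr_sqrtr SV0) lerXn2r ?nnegrE ?sqrtr_ge0 //.
apply: mx_norm_le; rewrite ?sqrtr_ge0 // => i j; rewrite ord1.
rewrite -sqrtr_sqr ler_wsqrtr // (le_trans ((sP i).2 x)) // mulrC ler_wpM2l //.
rewrite /S (bigD1 i) //= addrCA lerDl addr_ge0 // sumr_ge0 // => k _.
by rewrite ltW // (sP k).1.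
Qed.

Lemma qform_le_norm n (M : 'M[K]_n) x :
  `|qform M x| <= n%:R ^+ 2 * `|M| * `|x| ^+ 2.
Proof.
rewrite qform_sum.
have -> : n%:R ^+ 2 * `|M| * `|x| ^+ 2
    = \sum_(j < n) \sum_(i < n) `|x| * `|M| * `|x|.
  by rewrite !sumr_const !card_ord -[RHS]mulr_natr -[X in _ = X * _]mulr_natr; ring.
rewrite (le_trans (ler_norm_sum _ _ _)) // ler_sum // => j _.
rewrite mulr_suml (le_trans (ler_norm_sum _ _ _)) // ler_sum // => i _.
by rewrite !normrM !ler_pM ?mulr_ge0 ?entry_le_mx_norm.
Qed.

(** Positive definiteness survives small perturbations: a perturbation of norm at
    most c / (1 + n^2) changes the form by at most c |x|^2, where c is the
    coercivity constant of W. *)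
Lemma posdef_near_ge0 n (W : 'M[K]_n) : posdef W ->
  \forall M \near W, forall x, 0 <= qform M x.
Proof.
move=> /posdef_coercive[c c0 cW].
have N0 : 0 < 1 + n%:R ^+ 2 :> K by rewrite ltr_pwDl // sqr_ge0.
apply/nbhs_ballP; exists (c / (1 + n%:R ^+ 2)); first by rewrite /= divr_gt0.
move=> M; rewrite -ball_normE /= => WM x.
have -> : qform M x = qform W x - qform (W - M) x.
  by rewrite qformDl qformNl; ring.
rewrite subr_ge0 (le_trans (ler_norm _)) // (le_trans (qform_le_norm _ _)) //.
rewrite (le_trans _ (cW x)) // ler_wpM2r ?sqr_ge0 //.
move: WM; rewrite ltr_pdivlMr // => /ltW; apply: le_trans.
by rewrite mulrC ler_wpM2l // lerDr.
Qed.

End QuadraticForms.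

(** * Limits of matrix-valued functions *)

Section MatrixLimits.
Context {K : realType} {T : Type} {F : set_system T} {FF : Filter F}.

Lemma cvg_mxP m n (f : T -> 'M[K]_(m, n)) (M : 'M[K]_(m, n)) :
  f @ F --> M <-> forall i j, f x i j @[x --> F] --> M i j.
Proof.
split=> [fM i j|fM]; first exact: (cvg_comp f (fun N : 'M[K]_(m, n) => N i j) fM
    (@coord_continuous K m n i j M)).
move=> S [/= P MP PS]; apply: filterS PS _.
by apply: filter_forall => i; apply: filter_forall => j; exact/fM/MP.
Qed.

Lemma cvg_mulmx m n p (f : T -> 'M[K]_(m, n)) (g : T -> 'M[K]_(n, p))
    (M : 'M[K]_(m, n)) (N : 'M[K]_(n, p)) :
  f @ F --> M -> g @ F --> N -> f x *m g x @[x --> F] --> M *m N.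
Proof.
move=> /cvg_mxP fM /cvg_mxP gN; apply/cvg_mxP => i j.
under eq_fun do rewrite mxE; rewrite mxE.
apply: cvg_big; first exact: add_continuous.
by move=> k _; apply: cvgM; [exact: fM|exact: gN].
Qed.

Lemma cvg_mulmxl m n p (M : 'M[K]_(m, n)) (g : T -> 'M[K]_(n, p))
    (N : 'M[K]_(n, p)) :
  g @ F --> N -> M *m g x @[x --> F] --> M *m N.
Proof. by apply: cvg_mulmx; exact: cvg_cst. Qed.

Lemma cvg_mulmxr m n p (f : T -> 'M[K]_(m, n)) (M : 'M[K]_(m, n))
    (N : 'M[K]_(n, p)) :
  f @ F --> M -> f x *m N @[x --> F] --> M *m N.
Proof. by move=> fM; apply: cvg_mulmx fM _; exact: cvg_cst. Qed.

Lemma cvg_trmx m n (f : T -> 'M[K]_(m, n)) (M : 'M[K]_(m, n)) :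
  f @ F --> M -> (f x)^T @[x --> F] --> M^T.
Proof.
move=> /cvg_mxP fM; apply/cvg_mxP => i j.
by under eq_fun do rewrite mxE; rewrite mxE; exact: fM.
Qed.

End MatrixLimits.

(** * The Riccati equation and the decrease of the value function *)

(** The Riccati equation read as a Lyapunov equation of the closed loop.  With
    S = 2 R + B^T P B, the gain is characterized by S F = - B^T P A; this makes
    the quadratic term F^T S F cancel one of the two cross terms, and what
    remains is the right-hand side of the Riccati equation. *)
Lemma dare_closed_loop (K : realType) n m (A : 'M[K]_n) (B : 'M[K]_(n, m))
    (Q : 'M[K]_n) (R : 'M[K]_m) (P : 'M[K]_n) (F := dare_gain A B R P) :
  posdef R -> posdef P -> dare A B Q R P ->
  (A + B *m F)^T *m P *m (A + B *m F) = P - 2 *: (Q + F^T *m R *m F).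
Proof.
move=> pR pP dP.
pose S := 2 *: R + B^T *m P *m B.
have uS : S \in unitmx.
  by apply/posdef_unitmx/posdefD_congr => //; apply: posdefZ.
have SF : S *m F = - (B^T *m P *m A).
  by rewrite /F /dare_gain -/S mulmxN -!mulmxA mulKVmx.
have quad : F^T *m S *m F = - (F^T *m B^T *m P *m A).
  by rewrite -mulmxA SF mulmxN !mulmxA.
have PE : P = A^T *m P *m A + A^T *m P *m B *m F + 2 *: Q.
  rewrite {1}dP; congr (_ + _ + _).
  by rewrite /F /dare_gain mulmxN !mulmxA.
have E : (A + B *m F)^T *m P *m (A + B *m F) + F^T *m (2 *: R) *m F
    = A^T *m P *m A + A^T *m P *m B *m F
      + (F^T *m B^T *m P *m A + F^T *m S *m F).
  rewrite /S [(A + _)^T]linearD /= trmx_mul !(mulmxDl, mulmxDr) !mulmxA.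
  by rewrite -!addrA; congr (_ + _); rewrite addrCA; congr (_ + _);
    congr (_ + _); exact: addrC.
move: E; rewrite quad subrr addr0 -scalemxAr -scalemxAl => E.
by rewrite scalerDr opprD addrA {2}PE addrK -E addrK.
Qed.

(** The matrix on the left is the slack left by the decrease condition with stage
    cost W.  The factor 2 in the Lyapunov equation leaves a whole W of it in the
    limit, which is the margin that absorbs the nonlinearity. *)
Lemma cvg_lyapunov_slack (K : realType) n m (T : Type) (G : set_system T)
    (FG : Filter G) (A : T -> 'M[K]_n) (B : T -> 'M[K]_(n, m))
    (A0 : 'M[K]_n) (B0 : 'M[K]_(n, m)) (F : 'M[K]_(m, n)) (P W : 'M[K]_n) :
  A @ G --> A0 -> B @ G --> B0 ->
  (A0 + B0 *m F)^T *m P *m (A0 + B0 *m F) = P - 2 *: W ->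
  P - W - (A t + B t *m F)^T *m P *m (A t + B t *m F) @[t --> G] --> W.
Proof.
move=> cA cB E.
have ABF_cvg : A t + B t *m F @[t --> G] --> A0 + B0 *m F.
  exact: cvgD cA (cvg_mulmxr cB).
have {2}-> : W = P - W - (P - 2 *: W).
  by rewrite scaler_nat mulr2n opprB addrAC addrCA subrr addr0 addrK.
rewrite -E; apply: cvgB; first exact: cvg_cst.
exact: cvg_mulmx (cvg_mulmxr (cvg_trmx ABF_cvg)) ABF_cvg.
Qed.

Theorem proposition1 (K : realType) (n m : nat)
  (A : 'cV[K]_n -> 'cV[K]_m -> 'M[K]_n)
  (B : 'cV[K]_n -> 'cV[K]_m -> 'M[K]_(n, m))
  (X : set 'cV[K]_n) (U : set 'cV[K]_m)
  (Q Qhalf P : 'M[K]_n) (R : 'M[K]_m)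
  (LA LB : K)
  (X_closed : closed X) (U_closed : closed U)
  (Q_posdef : posdef Q) (R_posdef : posdef R)
  (A_C1 : continuously_differentiable (fun z : 'cV[K]_n * 'cV[K]_m => A z.1 z.2))
  (B_C1 : continuously_differentiable (fun z : 'cV[K]_n * 'cV[K]_m => B z.1 z.2))
  (LA_gt0 : 0 < LA) (LB_gt0 : 0 < LB)
  (A_lip : forall x x' u u',
     opnorm (A x u - A x' u') <= LA * (enorm (x - x') + enorm (u - u')))
  (B_lip : forall x x' u u',
     opnorm (B x u - B x' u') <= LB * (enorm (x - x') + enorm (u - u')))
  (AB_stabilizable : stabilizable (A 0 0) (B 0 0))
  (Qhalf_sqrt : is_principal_sqrt Q Qhalf)
  (AQ_detectable : detectable (A 0 0) Qhalf)
  (P_posdef : posdef P)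
  (P_dare : stabilizing_dare_solution (A 0 0) (B 0 0) Q R P)
  (X_int0 : interior X 0) (U_int0 : interior U 0) :
  let f := dynamics A B in
  let Kf := dare_gain (A 0 0) (B 0 0) R P in
  let kappaf (x : 'cV[K]_n) : 'cV[K]_m := Kf *m x in
  let Vf := qform P in
  exists2 alpha : K, 0 < alpha &
    let Xf := [set x : 'cV[K]_n | Vf x <= alpha] in
    [/\ (* (i) *)
        Xf `<=` X /\ (forall x, Xf x -> U (kappaf x)),
        (* (ii) *)
        forall x, Xf x -> Xf (f x (kappaf x)) &
        (* (iii) *)
        forall x, Xf x ->
          Vf (f x (kappaf x)) - Vf x <= - qform Q x - qform R (kappaf x)].
Proof.
move=> f Kf kappaf Vf.
pose Acl x := A x (kappaf x) + B x (kappaf x) *m Kf.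
pose W := Q + Kf^T *m R *m Kf.
have fE x : f x (kappaf x) = Acl x *m x.
  by rewrite /f /dynamics /Acl mulmxDl -mulmxA.
have WP : posdef W by exact: posdefD_congr.
have kappa_cvg : kappaf x @[x --> (0 : 'cV[K]_n)] --> (0 : 'cV[K]_m).
  rewrite -(mulmx0 _ Kf).
  exact (cvg_mulmxl (@cvg_id _ (nbhs (0 : 'cV[K]_n)))).
have graph_cvg :
    (x, kappaf x) @[x --> (0 : 'cV[K]_n)] --> (0 : 'cV[K]_n * 'cV[K]_m).
  exact (cvg_pair (@cvg_id _ (nbhs (0 : 'cV[K]_n))) kappa_cvg).
have along_graph p q (G : 'cV[K]_n * 'cV[K]_m -> 'M[K]_(p, q)) :
    differentiable G 0 -> G (x, kappaf x) @[x --> (0 : 'cV[K]_n)] --> G 0.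
  move=> /differentiable_continuous cG.
  exact (cvg_comp _ G graph_cvg cG).
have slack_cvg :
    P - W - (Acl x)^T *m P *m Acl x @[x --> (0 : 'cV[K]_n)] --> W.
  apply: (cvg_lyapunov_slack _ (along_graph _ _ _ (A_C1.1 0))
    (along_graph _ _ _ (B_C1.1 0))).
  exact: dare_closed_loop R_posdef P_posdef P_dare.1.
have : \forall x \near (0 : 'cV[K]_n), [/\ X x, U (kappaf x) &
    forall y, 0 <= qform (P - W - (Acl x)^T *m P *m Acl x) y].
  near=> x; split; near: x.
  - exact: X_int0.
  - exact: kappa_cvg U_int0.
  - exact: slack_cvg (posdef_near_ge0 WP).
move=> /nbhs_ballP[r /= r0 near0].
(* By coercivity of P, a sublevel set of level c (r / 2)^2 lies in the closed
   ball of radius r / 2, hence in the open ball of radius r. *)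
have [c c0 cP] := posdef_coercive P_posdef.
have alpha0 : 0 < c * (r / 2) ^+ 2 by rewrite mulr_gt0 // exprn_gt0 // divr_gt0.
exists (c * (r / 2) ^+ 2) => //=.
have good x : Vf x <= c * (r / 2) ^+ 2 -> [/\ X x, U (kappaf x) &
    Vf (f x (kappaf x)) - Vf x <= - qform Q x - qform R (kappaf x)].
  move=> Vx; have [Xx Ux slack] : [/\ X x, U (kappaf x) &
      forall y, 0 <= qform (P - W - (Acl x)^T *m P *m Acl x) y].
    apply: near0; rewrite -ball_normE /= sub0r normrN.
    have xr : `|x| <= r / 2.
      have := le_trans (cP x) Vx; rewrite ler_pM2l //.
      by rewrite ler_pXn2r // nnegrE // ltW // divr_gt0.
    by rewrite (le_lt_trans xr) // ltr_pdivrMr // ltr_pMr // ltr1n.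
  split=> //; have := slack x.
  by rewrite /Vf fE /kappaf !(qformDl, qformNl) !qform_congr; lra.
split=> [|x Vx|x Vx]; last by have [] := good x Vx.
  by split=> x Vx; have [] := good x Vx.
(* The stage cost is nonnegative, so the decrease keeps the successor of x
   in the sublevel set. *)
have [_ _ dec] := good x Vx.
have Q0 := posdef_ge0 x Q_posdef.
have R0 := posdef_ge0 (kappaf x) R_posdef.
rewrite -/Vf in Vx dec *; apply: le_trans Vx; lra.
Unshelve. all: by end_near. Qed.
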